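(* If a finite Markov chain $(X,Q,\pi)$ satisfies $CD_{ent}(K,\infty)$ for some $K>0$, then $$\mathrm{diam}(X,d_\Gamma)\le\frac2K\sqrt{\frac{2D_\pi\log D_\pi}{D_\pi-1}},$$ where $D_\pi:=\max_{x\in X}\frac{1}{\pi(x)}\sum_{y\sim x}\pi(y)$ is the maximal $\pi$-vertex degree, and $\frac{D_\pi\log D_\pi}{D_\pi-1}:=1$ if $D_\pi=1$.
   Context: A finite Markov chain $(X,Q,\pi)$ is always assumed irreducible and reversible: $X$ is a finite set, $Q:X\times X\to[0,1]$ satisfies $\sum_{y}Q(x,y)=1$ for all $x$ and is irreducible, $\pi\in(0,1]^X$ is the unique stationary probability measure, and $Q(x,y)\pi(x)=Q(y,x)\pi(y)$ for all $x,y$. Write $x\sim y$ if $x\ne y$ and $Q(x,y)>0$. For $f,g\in\mathbb{R}^X$ put $\langle f,g\rangle_\pi=\sum_{x}f(x)g(x)\pi(x)$, $\Delta f(x)=\sum_{y}(f(y)-f(x))Q(x,y)$, and $\Gamma f(x)=\frac12\sum_{y}(f(y)-f(x))^2Q(x,y)$. The logarithmic mean is $\theta_{log}(r,s)=\int_0^1r^{1-p}s^p\,dp$, and $\partial_1\theta_{log}(r,s)=\frac{\partial}{\partial r}\theta_{log}(r,s)$ for $r,s>0$. For $\rho\in(0,\infty)^X$ define $\Delta_\rho f(x)=\sum_{y}2\,\partial_1\theta_{log}(\rho(x),\rho(y))(f(y)-f(x))Q(x,y)$, $2\Gamma_\rho(f,g)=\Delta_\rho(fg)-f\Delta_\rho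 g-g\Delta_\rho f$, $2\Gamma_{2,\rho}(f,g)=\Delta\Gamma_\rho(f,g)-\Gamma_\rho(f,\Delta g)-\Gamma_\rho(g,\Delta f)$, and $\Gamma_\rho f=\Gamma_\rho(f,f)$, $\Gamma_{2,\rho}f=\Gamma_{2,\rho}(f,f)$. $X$ satisfies $CD_{ent}(K,\infty)$ if $\langle\rho,\Gamma_{2,\rho}f-K\Gamma_\rho f\rangle_\pi\ge0$ for all $\rho\in(0,\infty)^X$ and all $f\in\mathbb{R}^X$. The distance $d_\Gamma$ is $d_\Gamma(x,y)=\sup\{f(y)-f(x): f\in\mathbb{R}^X,\ \|\Gamma f\|_\infty\le1\}$, and $\mathrm{diam}(X,d_\Gamma)=\max_{x,y\in X}d_\Gamma(x,y)$. *)

(* Defs.v *)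
From HB Require Import structures.
From mathcomp Require Import all_boot all_order all_algebra.
From mathcomp Require Import all_classical all_reals all_analysis.

Set Implicit Arguments.
Unset Strict Implicit.
Unset Printing Implicit Defensive.

Import Order.TTheory GRing.Theory Num.Theory.
Import numFieldNormedType.Exports.

Local Open Scope classical_set_scope.
Local Open Scope ring_scope.

(* Uniqueness of the stationary probability measure is not a field: it follows
   from irreducibility. *)
Record finite_markov_chain (R : realType) (X : finType)
    (Q : X -> X -> R) (pi : X -> R) : Prop := FiniteMarkovChain {
  mc_transition_unit : forall x y, 0 <= Q x y <= 1 ;
  mc_transition_sum1 : forall x, \sum_y Q x y = 1 ;
  mc_irreducible : forall x y, connect (fun u v => 0 < Q u v) x y ;
  mc_measure_unit : forall x, 0 < pi x <= 1 ;
  mc_measure_sum1 : \sum_x pi x = 1 ;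
  mc_stationary : forall y, \sum_x pi x * Q x y = pi y ;
  mc_reversible : forall x y, Q x y * pi x = Q y x * pi y
}.

Section MarkovChain.
Context {R : realType} {X : finType}.
Implicit Types (Q : X -> X -> R) (pi rho f g : X -> R) (x y : X) (K r s : R).

Definition adjacent Q x y : bool := (x != y) && (0 < Q x y).

Definition inner pi f g : R := \sum_x f x * g x * pi x.

Definition laplacian Q f x : R := \sum_y (f y - f x) * Q x y.

Definition Gamma Q f x : R := 2^-1 * \sum_y (f y - f x) ^+ 2 * Q x y.

Definition theta_log r s : R :=
  \int[lebesgue_measure]_(p in `[0, 1]) (r `^ (1 - p) * s `^ p).

Definition partial1_theta_log r s : R := derive1 (fun t => theta_log t s) r.

Definition laplacian_rho Q rho f x : R :=
  \sum_y 2 * partial1_theta_log (rho x) (rho y) * (f y - f x) * Q x y.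

Definition Gamma_rho Q rho f g x : R :=
  2^-1 * (laplacian_rho Q rho (fun z => f z * g z) x
          - f x * laplacian_rho Q rho g x - g x * laplacian_rho Q rho f x).

Definition Gamma2_rho Q rho f g x : R :=
  2^-1 * (laplacian Q (Gamma_rho Q rho f g) x
          - Gamma_rho Q rho f (laplacian Q g) x
          - Gamma_rho Q rho g (laplacian Q f) x).

Definition CD_ent Q pi K : Prop :=
  forall rho f, (forall x, 0 < rho x) ->
    0 <= inner pi rho
           (fun x => Gamma2_rho Q rho f f x - K * Gamma_rho Q rho f f x).

Definition norm_infty f : R := \big[Num.max/0]_x `|f x|.

(* Extended-real valued, so that the supremum is meaningful without a prior
   proof of boundedness. *)
Definition dist_Gamma Q x y : \bar R :=
  ereal_sup [set (f y - f x)%:E | f in [set f | norm_infty (Gamma Q f) <= 1]].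

Definition diam_Gamma Q : \bar R :=
  \big[maxe/-oo%E]_x \big[maxe/-oo%E]_y dist_Gamma Q x y.

(* The terms are nonnegative and X carries a probability measure, hence is
   nonempty, so the default value 0 is harmless. *)
Definition max_degree Q pi : R :=
  \big[Num.max/0]_x ((pi x)^-1 * \sum_(y | adjacent Q x y) pi y).

(* For a one-point chain D = 0, and the value is 0 (ln 0 = 0 by convention),
   which matches the reading 0 log 0 = 0. *)
Definition log_ratio (D : R) : R :=
  if D == 1 then 1 else D * ln D / (D - 1).

End MarkovChain.

(* Main.v *)
Require Import Defs.
From HB Require Import structures.
From mathcomp Require Import all_boot all_order all_algebra.
From mathcomp Require Import all_classical all_reals all_analysis.
From mathcomp Require Import ring lra.

Set Implicit Arguments.
Unset Strict Implicit.
Unset Printing Implicit Defensive.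

Import Order.TTheory GRing.Theory Num.Theory.
Import numFieldNormedType.Exports.

Local Open Scope ring_scope.

(** Write [P_t] for the heat semigroup generated by the Laplacian and let
    [A(rho, f) = <rho, Gamma_rho f>].  Reversibility and Euler's identity for
    the 1-homogeneous logarithmic mean give
      [A(rho, f) = 1/2 sum_(x,y) theta(rho x, rho y) (f y - f x)^2 Q x y pi x]
    ([inner_Gamma_rho]).  Along the curve [s |-> (P_s rho, P_(t-s) f)] the
    derivative of [A] is twice [<rho, Gamma_(2,rho) f>] taken at the current
    point, so the curvature condition and Gronwall's argument yield the
    gradient estimate ([log_mean_form_heat])
      [A(rho, P_t f) <= e^(-2Kt) A(P_t rho, f)].

    Suppose [Gamma f <= 1].  As the logarithmic mean is at most the arithmetic
    mean, [A(P_t rho, f)] is at most the mass of [P_t rho], which is the mass of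
    [rho].  To read off a pointwise bound at [x], let [rho] be [1] at [x],
    [1/D] on the neighbours of [x] and almost [0] elsewhere.  Its mass is at
    most about [2 pi x], while
    [A(rho, g) >= theta(1, 1/D) pi x sum_y (g y - g x)^2 Q x y].
    Since [theta(1, 1/D) = (D - 1) / (D log D) = 1 / c], where [c] is the ratio
    in the theorem, this gives ([heat_increment_decay])
      [sum_y (P_t f y - P_t f x)^2 Q x y <= 2 c e^(-2Kt)].

    The estimate is used twice.  By Cauchy-Schwarz,
    [|d/dt P_t f x| <= sqrt (2 c) e^(-Kt)], so that the heat flow moves the
    value at each vertex by at most [sqrt (2 c) / K] in total
    ([heat_displacement]).  And, summing over a path, the oscillation of
    [P_t f] tends to [0].  Going from [f x] to [P_t f x], on to [P_t f y] and
    back to [f y] costs at most [2 sqrt (2 c) / K] in the limit. *)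

(** * Calculus on the real line *)

Section EntireSeries.
Context {R : realType}.
Implicit Types (c : nat -> R) (M x w : R).

(** Such coefficients give an entire power series, and unlike mere
    convergence the bound passes trivially to the derived series. *)
Definition exp_bounded c := exists M, forall n, `|c n| <= M / n`!%:R.

Lemma exp_bounded_cvg c x : exp_bounded c -> cvgn (pseries c x).
Proof.
move=> [M cM]; apply: normed_cvg.
apply: (@series_le_cvg _ _ (fun n => M * exp_coeff `|x| n)).
- by move=> n; rewrite normr_ge0.
- move=> n; rewrite /exp_coeff mulr_ge0 ?divr_ge0 ?exprn_ge0//.
  have := cM 0%N; rewrite fact0 divr1; exact: le_trans.
- move=> n; rewrite /= normrM normrX /exp_coeff mulrCA [leRHS]mulrC.
  by rewrite ler_wpM2r ?exprn_ge0.
- rewrite (_ : (fun n => _) = M *: exp_coeff `|x|); last exact/funext.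
  apply: is_cvg_seriesZ; exact: is_cvg_series_exp_coeff.
Qed.

Lemma exp_bounded_diffs c : exp_bounded c -> exp_bounded (pseries_diffs c).
Proof.
move=> [M cM]; exists M => n; rewrite /pseries_diffs normrM normr_nat.
have /(ler_wpM2l (ler0n R n.+1)) := cM n.+1; move/le_trans; apply.
by rewrite factS natrM invfM mulrCA mulVKf// ?pnatr_eq0.
Qed.

Lemma is_derive_entire c x : exp_bounded c ->
  is_derive x (1 : R) (fun x => limn (pseries c x))
    (limn (pseries (pseries_diffs c) x)).
Proof.
move=> cb; apply: (@pseries_snd_diffs _ _ (`|x| + 1)).
- exact: exp_bounded_cvg.
- exact/exp_bounded_cvg/exp_bounded_diffs.
- exact/exp_bounded_cvg/exp_bounded_diffs/exp_bounded_diffs.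
- by rewrite [ltRHS]ger0_norm ?addr_ge0// ltrDl.
Qed.

Lemma pseries_at0 c : limn (pseries c 0) = c 0%N.
Proof.
apply: lim_near_cst => //; exists 1%N => //= n; case: n => // n _.
rewrite /pseries /series /= big_nat_recl// expr0 mulr1 big1 ?addr0// => i _.
by rewrite expr0n mulr0.
Qed.

End EntireSeries.

Section RealCalculus.
Context {R : realType}.

Lemma is_derive_ge0_le (f f' : R -> R) (a b : R) : a <= b ->
  (forall x, a <= x <= b -> is_derive x (1:R) f (f' x)) ->
  (forall x, a <= x <= b -> 0 <= f' x) -> f a <= f b.
Proof.
move=> ab df f'0; have [||c cab] := @MVT_segment _ f f' _ _ ab.
- by move=> x /subset_itv_oo_cc; rewrite in_itv /= => /df.
- apply: derivable_within_continuous => x; rewrite in_itv /= => /df[].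
  by move=> + _; exact.
- move: cab; rewrite in_itv /= => /f'0 ? /eqP; rewrite subr_eq => /eqP ->.
  by rewrite lerDr mulr_ge0// subr_ge0.
Qed.

Lemma is_derive_sum_seq (I : Type) (r : seq I) (F : I -> R -> R)
    (F' : I -> R) (t : R) :
  (forall i, is_derive t (1:R) (F i) (F' i)) ->
  is_derive t (1:R) (fun t => \sum_(i <- r) F i t) (\sum_(i <- r) F' i).
Proof.
move=> dF; elim: r => [|i r IH].
  by rewrite big_nil; under eq_fun do rewrite big_nil; exact: is_derive_cst.
rewrite big_cons; under eq_fun do rewrite big_cons.
exact: (is_deriveD (dF i) IH).
Qed.

End RealCalculus.

(** * The mean of the exponential over [0, w] *)

Section MeanExp.
Context {R : realType}.
Implicit Types (r s w x : R).

(** This is the integral of [p |-> expR (p * w)] over [0, 1], that is the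
    logarithmic mean of [1] and [expR w]; by homogeneity it reduces the
    two-variable logarithmic mean to a function of one variable. *)
Definition mean_exp w : R := if w == 0 then 1 else (expR w - 1) / w.

Lemma mulr_mean_exp w : w * mean_exp w = expR w - 1.
Proof.
rewrite /mean_exp; case: eqVneq => [->|w0]; first by rewrite mul0r expR0 subrr.
by rewrite mulrC divfK.
Qed.

Lemma inv_factS_bounded : exp_bounded (fun n => (n.+1)`!%:R^-1 : R).
Proof.
exists 1 => n; rewrite ger0_norm ?invr_ge0 ?ler0n// mul1r.
by rewrite lef_pV2 ?posrE ?ltr0n ?fact_gt0// ler_nat factS leq_pmull.
Qed.

(** The closed form has a removable singularity at [0]; the power series is what
    makes differentiability there visible. *)
Lemma mean_exp_series w :
  mean_exp w = limn (pseries (fun n => (n.+1)`!%:R^-1) w).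
Proof.
have [->|w0] := eqVneq w 0; first by rewrite pseries_at0 /mean_exp eqxx invr1.
apply: (mulfI w0); rewrite mulr_mean_exp.
have lim_shift : (w * pseries (fun n => (n.+1)`!%:R^-1) w n @[n --> \oo] -->
    w * limn (pseries (fun n => (n.+1)`!%:R^-1) w))%classic.
  by apply: cvgMl_tmp; exact/exp_bounded_cvg/inv_factS_bounded.
have lim_exp : (series (exp_coeff w) n.+1 - 1 @[n --> \oo] --> expR w - 1)%classic.
  apply: cvgB; last exact: cvg_cst.
  rewrite (cvg_shiftS (series (exp_coeff w))); exact: is_cvg_series_exp_coeff.
apply: (cvg_unique _ lim_exp) => //.
apply: cvg_trans lim_shift; apply: near_eq_cvg; near=> n.
rewrite /series /= big_nat_recl// /exp_coeff /= fact0 expr0 divr1 addrC addKr.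
rewrite mulr_sumr; apply: eq_bigr => i _.
by rewrite /= exprS mulrCA mulrC.
Unshelve. all: by end_near. Qed.

Lemma derivable_mean_exp w : derivable mean_exp w 1.
Proof.
rewrite (_ : mean_exp = fun w => limn (pseries (fun n => (n.+1)`!%:R^-1) w)); last first.
  by apply/funext => v; rewrite mean_exp_series.
exact/ex_derive/is_derive_entire/inv_factS_bounded.
Qed.

Definition mean_exp' := derive1 mean_exp.

Lemma is_derive_mean_exp w : is_derive w (1:R) mean_exp (mean_exp' w).
Proof. rewrite /mean_exp' derive1E; exact/derivableP/derivable_mean_exp. Qed.

(** The functional equation behind the symmetry of the logarithmic mean; its
    derivative, stated next, is behind Euler's identity. *)
Lemma mean_expN w : mean_exp (- w) = expR (- w) * mean_exp w.
Proof.
rewrite /mean_exp oppr_eq0; case: eqVneq => [->|w0]; first by rewrite oppr0 expR0 mulr1.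
rewrite expRN invrN mulrN -mulNr opprB mulrA mulrBr mulr1 mulVf ?gt_eqF ?expR_gt0//.
Qed.

Lemma mean_exp'N w : mean_exp' (- w) = expR (- w) * (mean_exp w - mean_exp' w).
Proof.
have dN : is_derive w (1:R) (mean_exp \o -%R) (- mean_exp' (- w)).
  apply: is_derive_eq; first exact: is_derive1_comp (is_derive_mean_exp _) _.
  by rewrite mulrN1.
have dE : is_derive w (1:R) (mean_exp \o -%R) (expR (- w) * (mean_exp' w - mean_exp w)).
  have -> : mean_exp \o -%R = (expR \o -%R) * mean_exp.
    by apply/funext => v /=; rewrite mean_expN.
  apply: is_derive_eq.
    by apply: is_deriveM; exact: is_derive_mean_exp.
  by rewrite /= /GRing.scale /=; ring.
have [_ e1] := dN; have [_] := dE; rewrite e1 => /(congr1 -%R).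
by rewrite opprK => ->; rewrite -mulrN opprB.
Qed.

End MeanExp.

(** * The logarithmic mean *)

Section LogarithmicMean.
Context {R : realType}.
Implicit Types (r s t : R).

Lemma theta_logE r s : 0 < r -> 0 < s ->
  theta_log r s = r * mean_exp (ln s - ln r).
Proof.
move=> r0 s0; rewrite /theta_log; set w := ln s - ln r.
have integrandE p : r `^ (1 - p) * s `^ p = r * expR (p * w).
  rewrite /powR !gt_eqF// -expRD -[r in RHS]lnK ?posrE// -expRD.
  apply: (congr1 expR); rewrite /w; ring.
under eq_Rintegral do rewrite integrandE.
rewrite /mean_exp; case: eqVneq => [->|w0].
  under eq_Rintegral do rewrite mulr0 expR0.
  rewrite Rintegral_cst//= lebesgue_measure_itv /= lte_fin ltr01.
  by rewrite oppr0 adde0 /= !mulr1.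
rewrite /Rintegral.
have dF p : is_derive p (1:R) (fun p => r / w * expR (p * w)) (r * expR (p * w)).
  have -> : (fun p => r / w * expR (p * w)) = (r / w) \*: (expR \o ( w \*: id)).
    by apply/funext => q; rewrite /= /GRing.scale/= [q * w]mulrC.
  apply: is_derive_eq.
  rewrite /= /GRing.scale/= [p * w]mulrC.
  by field.
have cF (f : R -> R) (f' : R -> R) : (forall p, is_derive p (1:R) f (f' p)) -> continuous f.
  move=> df p; apply/differentiable_continuous/derivable1_diffP.
  by have [] := df p.
rewrite (@continuous_FTC2 _ _ (fun p => r / w * expR (p * w))) //.
- by rewrite mul0r mul1r expR0 -EFinB /=; ring.
- apply: continuous_subspaceT => p.
  have -> : (fun p => r * expR (p * w)) = fun p => w * (r / w * expR (p * w)).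
    by apply/funext => q; field.
  by apply: cvgMl_tmp; exact: (cF _ _ dF).
- split.
  + by move=> p _; have [] := dF p.
  + by apply: cvg_at_right_filter; exact: (cF _ _ dF).
  + by apply: cvg_at_left_filter; exact: (cF _ _ dF).
- move=> p _; rewrite derive1E; by have [] := dF p.
Qed.

Lemma theta_logC r s : 0 < r -> 0 < s -> theta_log r s = theta_log s r.
Proof.
move=> r0 s0; rewrite !theta_logE// -(opprB (ln s) (ln r)) mean_expN opprB mulrA; congr (_ * _).
by rewrite expRB !lnK ?posrE//; field; rewrite gt_eqF.
Qed.

Lemma partial1_theta_logE r s : 0 < r -> 0 < s ->
  partial1_theta_log r s =
    mean_exp (ln s - ln r) - mean_exp' (ln s - ln r).
Proof.
move=> r0 s0; rewrite /partial1_theta_log derive1E.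
have d : is_derive r (1:R) (id * (mean_exp \o (cst (ln s) - @ln R)))
    (mean_exp (ln s - ln r) - mean_exp' (ln s - ln r)).
  have dl := is_derive1_ln r0.
  have dm : is_derive ((cst (ln s) - @ln R) r) (1:R) mean_exp (mean_exp' (ln s - ln r)).
    exact: is_derive_mean_exp.
  apply: is_derive_eq.
  rewrite /GRing.scale /= !fctE /=.
  by field; rewrite gt_eqF.
have [_ <-] := d; apply: near_eq_derive => //.
near=> t; rewrite theta_logE//=.
by near: t; exact: lt_nbhsr.
Unshelve. all: by end_near. Qed.

(** Expressing the other partial derivative through the same point
    [ln s - ln r] lets identities mixing both partial derivatives be closed by
    field arithmetic. *)
Lemma partial1_theta_logC r s : 0 < r -> 0 < s ->
  partial1_theta_log s r = r / s * mean_exp' (ln s - ln r).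
Proof.
move=> r0 s0; rewrite partial1_theta_logE// -(opprB (ln s) (ln r)) mean_expN mean_exp'N.
rewrite opprB expRB !lnK ?posrE//; ring.
Qed.

(** Euler's identity for a symmetric 1-homogeneous function. *)
Lemma theta_log_euler r s : 0 < r -> 0 < s ->
  r * partial1_theta_log r s + s * partial1_theta_log s r = theta_log r s.
Proof.
move=> r0 s0; rewrite (partial1_theta_logC r0 s0) (partial1_theta_logE r0 s0) theta_logE//.
by field; rewrite gt_eqF.
Qed.

(** By homogeneity [theta_log (u t) (v t)] is
    [u t * mean_exp (ln (v t) - ln (u t))], so that the chain rule in two
    variables reduces to that of [mean_exp]. *)
Lemma is_derive_theta_log (u v : R -> R) (u' v' t : R) :
  is_derive t (1:R) u u' -> is_derive t (1:R) v v' -> 0 < u t -> 0 < v t ->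
  is_derive t (1:R) (fun t => theta_log (u t) (v t))
    (partial1_theta_log (u t) (v t) * u' + partial1_theta_log (v t) (u t) * v').
Proof.
move=> du dv u0 v0.
pose w z := ln (v z) - ln (u z).
have dw : is_derive t (1:R) w ((v t)^-1 * v' - (u t)^-1 * u').
  have dlu := is_derive1_ln u0; have dlv := is_derive1_ln v0.
  exact: (is_deriveB (is_derive1_comp dlv dv) (is_derive1_comp dlu du)).
have dm := is_derive1_comp (is_derive_mean_exp (w t)) dw.
have near_pos (f : R -> R) f' : is_derive t (1:R) f f' -> 0 < f t ->
    \forall z \near t, 0 < f z.
  move=> df f0; have cf : (f z @[z --> t] --> f t)%classic.
    by apply/differentiable_continuous/derivable1_diffP; case: df.
  by have /cvgr_gt := cf; exact.
apply: (@near_eq_is_derive _ _ _ (u * (mean_exp \o w))) => //.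
  near=> z; rewrite theta_logE//=; first by near: z; exact: near_pos du _.
  by near: z; exact: near_pos dv _.
apply: is_derive_eq.
rewrite (partial1_theta_logC u0 v0) (partial1_theta_logE u0 v0) /GRing.scale /=.
by field; rewrite !gt_eqF.
Unshelve. all: by end_near. Qed.

Lemma theta_log_ge0 r s : 0 <= theta_log r s.
Proof.
by apply: Rintegral_ge0 => p _; rewrite mulr_ge0 ?powR_ge0.
Qed.

(** With [w = ln (s / r)] the claim compares [2 (e^w - 1)] with [w (1 + e^w)],
    with a sign depending on that of [w].  The difference vanishes at [0] and is
    nondecreasing, because its derivative is [e^w (e^(-w) - 1 + w)]. *)
Lemma theta_log_le_mean r s : 0 < r -> 0 < s -> theta_log r s <= (r + s) / 2.
Proof.
move=> r0 s0; rewrite theta_logE//.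
have -> : (r + s) / 2 = r * ((1 + expR (ln s - ln r)) / 2).
  by rewrite expRB !lnK ?posrE//; field; rewrite gt_eqF.
rewrite ler_pM2l//; move: (ln s - ln r) => w {r s r0 s0}.
have mono : {homo (fun w => w * (1 + expR w) - 2 * (expR w - 1) : R) : x y / x <= y}.
  have dh (x : R) : is_derive x (1:R) (id * (cst 1 + expR) - 2 \*: (expR - cst 1))
      (1 + x * expR x - expR x).
    by apply: is_derive_eq; rewrite /GRing.scale /= !fctE /=; ring.
  move=> x y xy; apply: (is_derive_ge0_le xy (fun z _ => dh z)) => z _.
  have : 0 <= expR z * (expR (- z) - (1 - z)).
    by rewrite mulr_ge0 ?expR_ge0// subr_ge0 expR_ge1Dx.
  by rewrite mulrBr -expRD subrr expR0; lra.
rewrite /mean_exp; case: eqVneq => [->|w0].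
  by rewrite expR0 -mulr2n divff// pnatr_eq0.
have [w_gt0|w_le0] := ltP 0 w.
  by have := mono 0 w (ltW w_gt0); rewrite mul0r expR0; rewrite ler_pdivrMr//; lra.
have w_lt0 : w < 0 by rewrite lt_neqAle w0.
have := mono w 0 w_le0; rewrite mul0r expR0; rewrite ler_ndivrMr//; lra.
Qed.

(** This is where the constant of the theorem comes from. *)
Lemma theta_log_inv (D : R) : 0 < D -> theta_log 1 D^-1 * log_ratio D = 1.
Proof.
move=> D0; rewrite theta_logE ?invr_gt0// ln1 subr0 lnV ?posrE// mul1r /log_ratio /mean_exp.
rewrite oppr_eq0; have [->|D1] := eqVneq D 1; first by rewrite ln1 eqxx mulr1.
have lnD : ln D != 0.
  by apply: contra_neq D1 => lnD; rewrite -[D]lnK ?posrE// lnD expR0.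
rewrite (negPf lnD) expRN lnK ?posrE//; field.
by rewrite ?lnD ?subr_eq0 ?D1 ?gt_eqF.
Qed.

End LogarithmicMean.

(** * The heat flow *)

Section HeatFlow.
Context {R : realType} {X : finType} (Q : X -> X -> R) (pi : X -> R).
Hypothesis chainQ : finite_markov_chain Q pi.
Implicit Types (f g : X -> R) (t M : R) (x y : X).

Definition markov_op f x : R := \sum_y Q x y * f y.

Lemma laplacianE f x : laplacian Q f x = markov_op f x - f x.
Proof.
rewrite /laplacian /markov_op -[in RHS](mulr1 (f x)) -(mc_transition_sum1 chainQ x).
by rewrite mulr_sumr -sumrB; apply: eq_bigr => y _; rewrite mulrBl mulrC.
Qed.

Lemma markov_op_le f M : (forall x, `|f x| <= M) -> forall x, `|markov_op f x| <= M.
Proof.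
move=> fM x; rewrite -[M]mul1r -(mc_transition_sum1 chainQ x) mulr_suml.
apply: le_trans (ler_norm_sum _ _ _) _; apply: ler_sum => y _.
have /andP[Q0 _] := mc_transition_unit chainQ x y.
by rewrite normrM ger0_norm// ler_wpM2l.
Qed.

Lemma markov_op_ge0 f : (forall x, 0 <= f x) -> forall x, 0 <= markov_op f x.
Proof.
move=> f0 x; apply: sumr_ge0 => y _; rewrite mulr_ge0//.
by have /andP[] := mc_transition_unit chainQ x y.
Qed.

Definition heat_coef f x (n : nat) : R := iter n markov_op f x / n`!%:R.

(** As the Laplacian is [Q - 1], its semigroup is [e^(-t) sum_n t^n Q^n / n!]; the
    positivity of [Q] makes every term nonnegative for [t >= 0]. *)
Definition heat f t x : R := expR (- t) * limn (pseries (heat_coef f x) t).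

Lemma heat_coef_bounded f x : exp_bounded (heat_coef f x).
Proof.
exists (\sum_y `|f y|) => n; rewrite normrM normfV normr_nat ler_wpM2r ?invr_ge0//.
elim: n x => [|n IH] x /=; last exact: markov_op_le.
by rewrite (bigD1 x)//= lerDl sumr_ge0.
Qed.

Lemma heat_coef_diffs f x :
  pseries_diffs (heat_coef f x) = fun n => \sum_y Q x y * heat_coef f y n.
Proof.
apply/funext => n; rewrite /pseries_diffs /heat_coef factS natrM invfM /=.
rewrite mulrCA mulVKf ?pnatr_eq0// /markov_op mulr_suml.
by apply: eq_bigr => y _; rewrite mulrA.
Qed.

Lemma is_derive_heat f x t :
  is_derive t (1:R) (fun t => heat f t x) (laplacian Q (heat f t) x).
Proof.
have dS := is_derive_entire t (heat_coef_bounded f x).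
have diffE : limn (pseries (pseries_diffs (heat_coef f x)) t) =
    \sum_y Q x y * limn (pseries (heat_coef f y) t).
  apply/cvg_lim => //.
  have -> : pseries (pseries_diffs (heat_coef f x)) t =
      fun n => \sum_y Q x y * pseries (heat_coef f y) t n.
    apply/funext => n; rewrite heat_coef_diffs /pseries /series /=.
    under [RHS]eq_bigr do rewrite mulr_sumr.
    rewrite exchange_big; apply: eq_bigr => i _; rewrite mulr_suml.
    by apply: eq_bigr => y _; rewrite mulrA.
  apply: (@cvg_big _ _ +%R) => [|y _]; first exact: add_continuous.
  apply: cvgMl_tmp.
  exact: exp_bounded_cvg (heat_coef_bounded f y).
rewrite diffE in dS.
have dE : is_derive t (1:R) (expR \o -%R) (expR (- t) * - 1).
  exact: is_derive1_comp.
have -> : (fun t => heat f t x) =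
    (expR \o -%R) * (fun t => limn (pseries (heat_coef f x) t)) by [].
apply: is_derive_eq.
rewrite /GRing.scale /= laplacianE /markov_op /heat mulrN1 mulrN mulrC.
rewrite [X in _ - X]mulrC mulr_suml; congr (_ - _); apply: eq_bigr => y _.
by rewrite mulrAC mulrA.
Qed.

Lemma heat_at0 f x : heat f 0 x = f x.
Proof. by rewrite /heat oppr0 expR0 mul1r pseries_at0 /heat_coef fact0 divr1. Qed.

(** The term of index [0] is [f x > 0] and the others are nonnegative. *)
Lemma heat_gt0 f t x : (forall x, 0 < f x) -> 0 <= t -> 0 < heat f t x.
Proof.
move=> f0 t0; rewrite /heat mulr_gt0 ?expR_gt0//.
apply: (lt_le_trans (f0 x)); apply: limr_ge.
  exact/exp_bounded_cvg/heat_coef_bounded.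
exists 1%N => // -[//|n] _; rewrite /pseries /series /= big_nat_recl//.
rewrite /heat_coef /= fact0 divr1 expr0 mulr1 lerDl.
apply: sumr_ge0 => i _; rewrite mulr_ge0 ?exprn_ge0// divr_ge0//.
have iter_ge0 n' : forall x, 0 <= iter n' markov_op f x.
  by elim: n' => [|n' IH] y /=; [exact: ltW | exact: markov_op_ge0].
exact: (iter_ge0 i.+1).
Qed.

End HeatFlow.

(** * The gradient estimate *)

Section GradientEstimate.
Context {R : realType} {X : finType} (Q : X -> X -> R) (pi : X -> R).
Hypothesis chainQ : finite_markov_chain Q pi.
Implicit Types (rho f g h : X -> R) (s t : R) (x y : X).

(** The Dirichlet form of the chain in which each edge carries the extra weight
    [theta_log (rho x) (rho y)]: the symmetric form of [<rho, Gamma_rho (f, g)>],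
    see [inner_Gamma_rho]. *)
Definition log_mean_form rho f g : R :=
  2^-1 * \sum_x \sum_y
    theta_log (rho x) (rho y) * (f y - f x) * (g y - g x) * (Q x y * pi x).

Lemma sum_symmetrize (F : X -> X -> R) :
  \sum_x \sum_y F x y = 2^-1 * \sum_x \sum_y (F x y + F y x).
Proof.
under [in RHS]eq_bigr do rewrite big_split /=.
rewrite big_split /= [X in _ + X]exchange_big /= -mulr2n.
by rewrite -[X in _ * X]mulr_natl mulKf ?pnatr_eq0.
Qed.

Lemma Gamma_rhoE rho f g x : Gamma_rho Q rho f g x =
  \sum_y partial1_theta_log (rho x) (rho y) * (f y - f x) * (g y - g x) * Q x y.
Proof.
rewrite /Gamma_rho /laplacian_rho !mulr_sumr -!sumrB mulr_sumr.
by apply: eq_bigr => y _; field.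
Qed.

(** Exchanging [x] and [y] turns the weight [rho x * partial1 (x, y)] into the
    average of it and its mirror image, which Euler's identity evaluates. *)
Lemma inner_Gamma_rho rho f g : (forall x, 0 < rho x) ->
  inner pi rho (Gamma_rho Q rho f g) = log_mean_form rho f g.
Proof.
move=> rho0; rewrite /inner /log_mean_form.
under eq_bigr do rewrite Gamma_rhoE mulr_sumr mulr_suml.
rewrite sum_symmetrize; congr (_ * _).
apply: eq_bigr => x _; apply: eq_bigr => y _.
rewrite -(theta_log_euler (rho0 x) (rho0 y)).
move: (partial1_theta_log _ _) (partial1_theta_log _ _) => p q.
have rev := mc_reversible chainQ x y. ring: rev.
Qed.

Lemma inner_laplacian g h :
  inner pi g (laplacian Q h) = inner pi (laplacian Q g) h.
Proof.
rewrite /inner /laplacian.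
under eq_bigr do rewrite mulr_sumr mulr_suml.
under [RHS]eq_bigr do rewrite !mulr_suml.
rewrite sum_symmetrize [RHS]sum_symmetrize; congr (_ * _).
apply: eq_bigr => x _; apply: eq_bigr => y _.
have rev := mc_reversible chainQ x y; ring: rev.
Qed.

(** Self-adjointness moves the Laplacian in [<rho, Delta Gamma_rho f>] onto
    [rho].  The right-hand side is then the derivative of
    [log_mean_form rho f f] when [rho] follows the heat flow and [f] the
    reversed heat flow, as [is_derive_log_mean_form] shows. *)
Lemma CD_ent_log_mean_form K rho f : CD_ent Q pi K -> (forall x, 0 < rho x) ->
  2 * K * log_mean_form rho f f <=
  inner pi (laplacian Q rho) (Gamma_rho Q rho f f)
    - 2 * log_mean_form rho f (laplacian Q f).
Proof.
move=> /(_ rho f) cdK rho0; have := cdK rho0.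
have -> : inner pi rho (fun x => Gamma2_rho Q rho f f x - K * Gamma_rho Q rho f f x)
    = 2^-1 * inner pi rho (laplacian Q (Gamma_rho Q rho f f))
      - inner pi rho (Gamma_rho Q rho f (laplacian Q f))
      - K * inner pi rho (Gamma_rho Q rho f f).
  rewrite /inner !mulr_sumr -!sumrB; apply: eq_bigr => x _.
  by rewrite /Gamma2_rho; field.
rewrite inner_laplacian !(inner_Gamma_rho _ _ rho0); lra.
Qed.

Lemma log_mean_formN rho f g :
  log_mean_form rho f (fun x => - g x) = - log_mean_form rho f g.
Proof.
rewrite /log_mean_form -mulrN -sumrN; congr (_ * _); apply: eq_bigr => x _.
by rewrite -sumrN; apply: eq_bigr => y _; ring.
Qed.

(** The variation of the weights produces [partial1 (x, y) u' x] and its mirror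
    image, so it is the symmetrization of [<u', Gamma_(u t) (v t)>]. *)
Lemma is_derive_log_mean_form (u v : R -> X -> R) (u' v' : X -> R) t :
  (forall x, is_derive t (1:R) (fun s => u s x) (u' x)) ->
  (forall x, is_derive t (1:R) (fun s => v s x) (v' x)) ->
  (forall x, 0 < u t x) ->
  is_derive t (1:R) (fun s => log_mean_form (u s) (v s) (v s))
    (inner pi u' (Gamma_rho Q (u t) (v t) (v t))
     + 2 * log_mean_form (u t) (v t) v').
Proof.
move=> du dv u0.
pose F x y : R -> R := fun s => theta_log (u s x) (u s y).
pose dF x y := partial1_theta_log (u t x) (u t y) * u' x
  + partial1_theta_log (u t y) (u t x) * u' y.
have dtheta x y : is_derive t (1:R) (F x y) (dF x y).
  exact: is_derive_theta_log.
pose V x y : R -> R := fun s => v s y - v s x.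
have dV x y : is_derive t (1:R) (V x y) (v' y - v' x).
  exact: (is_deriveB (dv y) (dv x)).
pose S : R -> R := fun s => \sum_x \sum_y Q x y * pi x * (F x y s * (V x y s * V x y s)).
have dS : is_derive t (1:R) S (\sum_x \sum_y ((Q x y * pi x) *:
    (F x y t *: (V x y t *: (v' y - v' x) + V x y t *: (v' y - v' x))
     + (V x y t * V x y t) *: dF x y))).
  apply: is_derive_sum_seq => x; apply: is_derive_sum_seq => y.
  exact: (is_deriveZ (Q x y * pi x) (is_deriveM (dtheta x y) (is_deriveM (dV x y) (dV x y)))).
have -> : (fun s => log_mean_form (u s) (v s) (v s)) = 2^-1 \*: S.
  apply/funext => s; rewrite /log_mean_form /S; congr (_ * _).
  apply: eq_bigr => x _; apply: eq_bigr => y _.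
  by rewrite /F /V /GRing.scale /=; ring.
apply: is_derive_eq.
rewrite /inner /log_mean_form mulrA divff ?pnatr_eq0// mul1r.
under [in RHS]eq_bigr do rewrite Gamma_rhoE mulr_sumr mulr_suml.
rewrite [X in _ = X + _]sum_symmetrize.
rewrite -[X in _ = _ + X](mulKf (_ : 2%:R != 0)) ?pnatr_eq0// -mulrDr; congr (_ * _).
rewrite mulr_sumr -big_split; apply: eq_bigr => x _ /=.
rewrite mulr_sumr -big_split; apply: eq_bigr => y _ /=.
rewrite /F /V /dF /GRing.scale /=.
move: (theta_log _ _) (partial1_theta_log _ _) (partial1_theta_log _ _) => a p q.
have rev := mc_reversible chainQ x y. ring: rev.
Qed.

(** Bakry-Emery interpolation: [e^(-2Ks) A(P_s rho, P_(t-s) f)] is nondecreasing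
    in [s], and the two sides are its values at [s = 0] and [s = t]. *)
Lemma log_mean_form_heat K rho f t : CD_ent Q pi K ->
  (forall x, 0 < rho x) -> 0 <= t ->
  log_mean_form rho (heat Q f t) (heat Q f t) <=
  expR (- (2 * K * t)) * log_mean_form (heat Q rho t) f f.
Proof.
move=> cdK rho0 t0.
pose u s := heat Q rho s; pose v s := heat Q f (t - s).
pose G s := log_mean_form (u s) (v s) (v s).
pose G' s := inner pi (laplacian Q (u s)) (Gamma_rho Q (u s) (v s) (v s))
  - 2 * log_mean_form (u s) (v s) (laplacian Q (v s)).
have dG s : 0 <= s -> is_derive s (1:R) G (G' s).
  move=> s0; rewrite /G' -mulrN -log_mean_formN.
  apply: is_derive_log_mean_form => x.
  - exact: (is_derive_heat chainQ).
  - have dts : is_derive s (1:R) (cst t - id) (0 - 1) by exact: is_deriveB.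
    have := is_derive1_comp (g := cst t - id) (is_derive_heat chainQ f x _) dts.
    by rewrite sub0r mulrN1; exact.
  - exact: (heat_gt0 chainQ).
pose E s := expR (- (2 * K * s)).
have dE s : is_derive s (1:R) E (- (2 * K) * E s).
  have -> : E = expR \o (- (2 * K) \*: id).
    by apply/funext => z; rewrite /E /= /GRing.scale /= mulNr.
  by apply: is_derive_eq; rewrite /= /GRing.scale /= mulr1 mulrC.
have E0 s : 0 <= E s by exact: expR_ge0.
pose H s := E s * G s.
have : H 0 <= H t.
  apply: (@is_derive_ge0_le _ H (fun s => E s * (G' s - 2 * K * G s)) _ _ t0).
    move=> s /andP[s0 _]; have := is_deriveM (dE s) (dG s s0).
    by rewrite /GRing.scale /=; congr is_derive; ring.
  move=> s /andP[s0 _]; rewrite mulr_ge0// subr_ge0.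
  by apply: CD_ent_log_mean_form => // x; exact: (heat_gt0 chainQ).
have v0 : v t = f.
  by apply/funext => x; rewrite /v subrr heat_at0.
have u0 : u 0 = rho by apply/funext => x; exact: heat_at0.
by rewrite /H /G v0 u0 /E mulr0 oppr0 expR0 mul1r /v subr0.
Qed.

(** The Laplacian is self-adjoint and kills constants. *)
Lemma heat_mass rho t : inner pi (heat Q rho t) (cst 1) = inner pi rho (cst 1).
Proof.
have dmass s : is_derive s (1:R) (fun s => inner pi (heat Q rho s) (cst 1)) 0.
  have -> : 0 = \sum_x (pi x *: laplacian Q (heat Q rho s) x).
    transitivity (inner pi (laplacian Q (heat Q rho s)) (cst 1)).
      rewrite -inner_laplacian /inner big1// => x _.
      rewrite [laplacian _ _ _](_ : _ = 0) ?mulr0 ?mul0r//.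
      by rewrite /laplacian big1// => y _; rewrite subrr mul0r.
    by apply: eq_bigr => x _; rewrite mulr1 mulrC.
  have -> : (fun s => inner pi (heat Q rho s) (cst 1)) =
      fun s => \sum_x (pi x * heat Q rho s x).
    by apply/funext => z; apply: eq_bigr => x _; rewrite mulr1 mulrC.
  apply: is_derive_sum_seq => x.
  exact: (is_deriveZ (pi x) (is_derive_heat chainQ rho x s)).
rewrite (is_derive_0_is_cst t 0 dmass); congr inner.
by apply/funext => x; rewrite heat_at0.
Qed.

(** Replacing [theta_log (rho x) (rho y)] by the arithmetic mean gives exactly
    [<rho, Gamma f>], after symmetrization. *)
Lemma log_mean_form_le_mass rho f : (forall x, 0 < rho x) ->
  (forall x, Gamma Q f x <= 1) ->
  log_mean_form rho f f <= inner pi rho (cst 1).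
Proof.
move=> rho0 Gf.
apply: (@le_trans _ _ (inner pi rho (Gamma Q f))); last first.
  apply: ler_sum => x _; have /andP[pi0 _] := mc_measure_unit chainQ x.
  by rewrite ler_pM2r// ler_pM2l.
rewrite /inner /log_mean_form /Gamma.
under [leRHS]eq_bigr do rewrite mulrCA -mulrA mulr_sumr mulr_suml.
rewrite -mulr_sumr ler_pM2l ?invr_gt0// [leRHS]sum_symmetrize mulr_sumr.
apply: ler_sum => x _; rewrite mulr_sumr; apply: ler_sum => y _.
have w0 : 0 <= (f y - f x) ^+ 2 * (Q x y * pi x).
  have /andP[Q0 _] := mc_transition_unit chainQ x y.
  have /andP[pi0 _] := mc_measure_unit chainQ x.
  by rewrite mulr_ge0 ?sqr_ge0// mulr_ge0// ltW.
have := ler_wpM2r w0 (theta_log_le_mean (rho0 x) (rho0 y)).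
move: (theta_log _ _) => a.
have rev := mc_reversible chainQ x y.
have -> : a * (f y - f x) * (f y - f x) * (Q x y * pi x) =
    a * ((f y - f x) ^+ 2 * (Q x y * pi x)) by ring.
move=> /le_trans; apply; rewrite le_eqVlt; apply/orP; left; apply/eqP.
have -> : rho y * ((f x - f y) ^+ 2 * Q y x) * pi y = rho y * (f x - f y) ^+ 2 * (Q x y * pi x).
  by rewrite rev; ring.
by field.
Qed.

End GradientEstimate.

(** * The diameter bound *)

Section DiameterBound.
Context {R : realType} {X : finType} (Q : X -> X -> R) (pi : X -> R) (K : R).
Hypothesis chainQ : finite_markov_chain Q pi.
Hypothesis K_gt0 : 0 < K.
Hypothesis cdK : CD_ent Q pi K.
Implicit Types (f : X -> R) (t eps : R) (x y z : X).

Local Notation D := (max_degree Q pi).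
Local Notation speed := (Num.sqrt (2 * log_ratio D)).

Lemma degree_le_max x : \sum_(y | Defs.adjacent Q x y) pi y <= D * pi x.
Proof.
have /andP[pi0 _] := mc_measure_unit chainQ x.
rewrite -ler_pdivrMr// mulrC /max_degree.
exact: (le_bigmax _ (fun x => (pi x)^-1 * \sum_(y | Defs.adjacent Q x y) pi y)).
Qed.

(** Taking a duplicate-free path out of [x] rules out that its first step is a
    loop at [x], which would not be an adjacency. *)
Lemma max_degree_gt0 x y : x != y -> 0 < D.
Proof.
move=> xy; have /connectP[p pP yE] := mc_irreducible chainQ x y.
case/shortenP: pP yE => -[|z p'] /=; first by move=> _ _ _ yE; rewrite yE eqxx in xy.
move=> /andP[Qxz _] /andP[]; rewrite inE negb_or => /andP[xz _] _ _ _.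
have /andP[pix _] := mc_measure_unit chainQ x.
have /andP[piz _] := mc_measure_unit chainQ z.
rewrite -(pmulr_lgt0 _ pix); apply: lt_le_trans (degree_le_max x).
rewrite (bigD1 z) /Defs.adjacent ?xz//= ltr_wpDr// sumr_ge0// => w _.
by have /andP[/ltW] := mc_measure_unit chainQ w.
Qed.

(** The test density concentrated on [x] and its neighbours.  The ratio [1/D]
    makes the neighbours weigh at most as much as [x] itself; [eps] only keeps
    the density positive, and is sent to [0]. *)
Definition star_density eps x z : R :=
  if z == x then 1 else if Defs.adjacent Q x z then D^-1 else eps.

Lemma star_density_gt0 eps x z : 0 < D -> 0 < eps -> 0 < star_density eps x z.
Proof. by rewrite /star_density => D0 e0; do 2?case: ifP; rewrite ?invr_gt0. Qed.

Lemma star_density_mass eps x : 0 < D -> 0 < eps ->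
  inner pi (star_density eps x) (cst 1) <= 2 * pi x + eps.
Proof.
move=> D0 e0; rewrite /inner.
have pi0 z : 0 < pi z by have /andP[] := mc_measure_unit chainQ z.
apply: (@le_trans _ _ (\sum_z ((if z == x then pi z else 0)
    + (if Defs.adjacent Q x z then D^-1 * pi z else 0) + eps * pi z))).
  apply: ler_sum => z _; rewrite mulr1 /star_density.
  have ? := pi0 z; have : 0 <= D^-1 * pi z by rewrite mulr_ge0 ?invr_ge0 ?ltW.
  have : 0 <= eps * pi z by rewrite mulr_ge0 ?ltW.
  by case: ifP => _; case: ifP => _; lra.
rewrite !big_split /= -!big_mkcond big_pred1_eq -!mulr_sumr (mc_measure_sum1 chainQ).
rewrite mulr1 lerD2r mulr_natl mulr2n lerD2l mulrC ler_pdivrMr// mulrC.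
exact: degree_le_max.
Qed.

(** Each edge at [x] occurs twice in the double sum, which cancels the factor
    1/2; all other terms are nonnegative. *)
Lemma star_density_form eps x f : 0 < D -> 0 < eps ->
  theta_log 1 D^-1 * pi x * (\sum_y (f y - f x) ^+ 2 * Q x y) <=
  log_mean_form Q pi (star_density eps x) f f.
Proof.
move=> D0 e0; rewrite /log_mean_form; set rho := star_density eps x.
have rho0 z : 0 < rho z by exact: star_density_gt0.
pose F y z := theta_log (rho y) (rho z) * (f z - f y) * (f z - f y) * (Q y z * pi y).
have Fsym y z : F y z = F z y.
  rewrite /F theta_logC// (mc_reversible chainQ y z).
  by move: (theta_log _ _) => a; ring.
have F0 y z : 0 <= F y z.
  have /andP[piy _] := mc_measure_unit chainQ y.
  have /andP[Qyz _] := mc_transition_unit chainQ y z.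
  rewrite /F -[_ * _ * (f z - f y)]mulrA -expr2; apply: mulr_ge0; apply: mulr_ge0 => //.
  - exact: theta_log_ge0.
  - exact: sqr_ge0.
  - exact: ltW.
have Fxx : F x x = 0 by rewrite /F subrr mulr0 mul0r.
have FE : theta_log 1 D^-1 * pi x * (\sum_y (f y - f x) ^+ 2 * Q x y) = \sum_y F x y.
  rewrite mulr_sumr; apply: eq_bigr => y _; rewrite /F /rho /star_density eqxx.
  have [->|yx] := eqVneq y x; first by rewrite subrr expr0n /= !(mulr0, mul0r).
  rewrite /Defs.adjacent eq_sym yx /=; case: ltP => [_|Q0].
    by move: (theta_log _ _) => a; ring.
  have /andP[Qxy _] := mc_transition_unit chainQ x y.
  have -> : Q x y = 0 by apply/le_anti/andP.
  by rewrite !(mulr0, mul0r).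
rewrite FE -[leLHS](mulKf (_ : 2%:R != 0)) ?pnatr_eq0// ler_pM2l ?invr_gt0//.
rewrite mulr_natl mulr2n [leRHS](bigD1 x)//= lerD2l.
rewrite (bigD1 x)//= Fxx add0r; apply: ler_sum => z zx.
by rewrite Fsym (bigD1 x)//= lerDl; apply: sumr_ge0 => w _; exact: F0.
Qed.

Lemma log_ratio_gt0 : 0 < D -> 0 < log_ratio D.
Proof.
move=> D0; have := theta_log_inv D0; have := theta_log_ge0 1 D^-1.
move: (theta_log _ _) => a a0 ac; rewrite ltNge; apply/negP => c0.
by have := mulr_ge0_le0 a0 c0; rewrite ac ler10.
Qed.

(** The gradient estimate tested with [star_density eps x], in the limit where
    [eps] tends to [0]. *)
Lemma heat_increment_decay f t x : 0 < D -> (forall z, Gamma Q f z <= 1) -> 0 <= t ->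
  \sum_y (heat Q f t y - heat Q f t x) ^+ 2 * Q x y <=
  (speed * expR (- (K * t))) ^+ 2.
Proof.
move=> D0 Gf t0; set S := \sum_y _.
have /andP[pi0 _] := mc_measure_unit chainQ x.
have c0 := log_ratio_gt0 D0.
rewrite exprMn sqr_sqrtr ?mulr_ge0 ?(ltW c0)// expr2 -expRD.
rewrite (_ : - (K * t) + - (K * t) = - (2 * K * t)); last by ring.
set e := expR _.
have e_le1 : e <= 1.
  by rewrite /e -expR0 ler_expR oppr_le0 !mulr_ge0// ltW.
have star : theta_log 1 D^-1 * pi x * S <= e * (2 * pi x).
  apply/ler_addgt0Pr => eps eps0.
  have rho0 z : 0 < star_density eps x z by exact: star_density_gt0.
  apply: le_trans (star_density_form x (heat Q f t) D0 eps0) _.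
  apply: le_trans (log_mean_form_heat chainQ f cdK rho0 t0) _.
  apply: (@le_trans _ _ (e * (2 * pi x + eps))).
    rewrite ler_pM2l ?expR_gt0//; apply: le_trans (star_density_mass x D0 eps0).
    rewrite -(heat_mass chainQ _ t); apply: log_mean_form_le_mass => // z.
    exact: (heat_gt0 chainQ).
  by rewrite mulrDr lerD2l ler_piMl// ltW.
have := theta_log_inv D0; move: star; move: (theta_log _ _) => a star ac.
rewrite -(ler_pM2l pi0).
rewrite -[leLHS]mul1r -[X in X * _ <= _]ac.
have := ler_wpM2l (ltW c0) star; congr (_ <= _); ring.
Qed.

(** Cauchy-Schwarz for the probability [Q x _]: the difference of the two sides
    is the variance of the increments of the heat flow at [x]. *)
Lemma heat_laplacian_decay f t x : 0 < D -> (forall z, Gamma Q f z <= 1) -> 0 <= t ->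
  `|laplacian Q (heat Q f t) x| <= speed * expR (- (K * t)).
Proof.
move=> D0 Gf t0; set g := heat Q f t.
rewrite -ler_sqr ?nnegrE ?mulr_ge0 ?sqrtr_ge0 ?expR_ge0// real_normK ?num_real//.
apply: le_trans (heat_increment_decay x D0 Gf t0); rewrite -/g -subr_ge0.
set m := laplacian Q g x.
rewrite (_ : _ - _ = \sum_y (g y - g x - m) ^+ 2 * Q x y).
  apply: sumr_ge0 => y _; rewrite mulr_ge0 ?sqr_ge0//.
  by have /andP[] := mc_transition_unit chainQ x y.
transitivity (\sum_y (g y - g x) ^+ 2 * Q x y
    - 2 * m * laplacian Q g x + m ^+ 2 * \sum_y Q x y).
  by rewrite (mc_transition_sum1 chainQ) -/m; ring.
move: m => m; rewrite /laplacian !mulr_sumr -sumrB -big_split /=.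
by apply: eq_bigr => y _; ring.
Qed.

(** Integration of the decay of the Laplacian over time, in the form that
    [sigma * P_s f x - speed / K * e^(-Ks)] is nondecreasing.  The factor
    [sigma] stands for either sign. *)
Lemma heat_displacement f t x (sigma : R) : 0 < D -> (forall z, Gamma Q f z <= 1) ->
  0 <= t -> `|sigma| <= 1 -> sigma * (f x - heat Q f t x) <= speed / K.
Proof.
move=> D0 Gf t0 sigma1.
pose H s := sigma * heat Q f s x - speed / K * expR (- (K * s)).
pose H' s := sigma * laplacian Q (heat Q f s) x + speed * expR (- (K * s)).
have dE s : is_derive s (1:R) (fun s => expR (- (K * s))) (- K * expR (- (K * s))).
  have -> : (fun s => expR (- (K * s))) = expR \o (- K \*: id).
    by apply/funext => z; rewrite /= /GRing.scale /= mulNr.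
  by apply: is_derive_eq; rewrite /= /GRing.scale /= mulr1 mulNr [LHS]mulrC.
have dH s : is_derive s (1:R) H (H' s).
  have := is_deriveB (is_deriveZ sigma (is_derive_heat chainQ f x s))
    (is_deriveZ (speed / K) (dE s)).
  rewrite /GRing.scale /= mulNr mulrN opprK mulrA divfK ?gt_eqF//.
have : H 0 <= H t.
  apply: (is_derive_ge0_le t0 (fun s _ => dH s)) => s /andP[s0 _].
  have decay : `|sigma * laplacian Q (heat Q f s) x| <= speed * expR (- (K * s)).
    apply: le_trans (heat_laplacian_decay x D0 Gf s0).
    by rewrite normrM ler_piMl.
  by move: decay; rewrite ler_norml /H' => /andP[+ _]; rewrite lerNl -subr_ge0 opprK addrC.
rewrite /H mulr0 oppr0 expR0 mulr1 heat_at0 mulrBr.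
have : 0 <= speed / K * expR (- (K * t)).
  by rewrite mulr_ge0 ?expR_ge0// divr_ge0 ?sqrtr_ge0// ltW.
lra.
Qed.

(** Along an edge the increment is controlled by [heat_increment_decay] up to the
    factor [1 / sqrt (Q x z)]; irreducibility gives a path, over which the
    constants add up. *)
Lemma heat_oscillation_decay f x y : 0 < D -> (forall z, Gamma Q f z <= 1) ->
  exists C, forall t, 0 <= t ->
    `|heat Q f t y - heat Q f t x| <= C * expR (- (K * t)).
Proof.
move=> D0 Gf; have /connectP[p pP ->] := mc_irreducible chainQ x y.
elim: p x pP => [|z p IH] x /=.
  by move=> _; exists 0 => t _; rewrite subrr normr0 mul0r.
move=> /andP[Qxz /IH[C hC]]; exists (C + speed / Num.sqrt (Q x z)) => t t0.
rewrite mulrDl (le_trans (ler_distD (heat Q f t z) _ _))// lerD ?hC//.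
rewrite mulrAC ler_pdivlMr ?sqrtr_gt0//.
rewrite -ler_sqr ?nnegrE ?mulr_ge0 ?sqrtr_ge0 ?expR_ge0//.
apply: le_trans (heat_increment_decay x D0 Gf t0).
rewrite exprMn sqr_sqrtr ?(ltW Qxz)// real_normK ?num_real// (bigD1 z)//= lerDl.
apply: sumr_ge0 => w _; rewrite mulr_ge0 ?sqr_ge0//.
by have /andP[] := mc_transition_unit chainQ x w.
Qed.

Lemma Gamma_lipschitz f x y : (forall z, Gamma Q f z <= 1) ->
  f y - f x <= 2 / K * speed.
Proof.
move=> Gf; have [->|xy] := eqVneq x y.
  by rewrite subrr mulr_ge0 ?sqrtr_ge0// divr_ge0// ltW.
have D0 := max_degree_gt0 xy; have [C hC] := heat_oscillation_decay x y D0 Gf.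
apply/ler_addgt0Pr => eps eps0.
(* Large enough for [|C| <= eps * (1 + K * t) <= eps * e^(K * t)]. *)
pose t := `|C| / (eps * K).
have t0 : 0 <= t by rewrite divr_ge0 ?mulr_ge0// ltW.
have osc : heat Q f t y - heat Q f t x <= eps.
  apply: le_trans (ler_norm _) _; apply: le_trans (hC t t0) _.
  rewrite expRN ler_pdivrMr ?expR_gt0//.
  apply: (@le_trans _ _ (eps * (1 + K * t))); last first.
    by rewrite ler_pM2l// expR_ge1Dx.
  rewrite /t mulrDr mulr1 (_ : eps * _ = `|C|); last by field; rewrite !gt_eqF.
  by rewrite (le_trans (ler_norm C))// lerDr ltW.
have upper : 1 * (f y - heat Q f t y) <= speed / K.
  by apply: heat_displacement => //; rewrite normr1.
have lower : (- 1) * (f x - heat Q f t x) <= speed / K.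
  by apply: heat_displacement => //; rewrite normrN1.
have -> : 2 / K * speed = speed / K + speed / K by ring.
lra.
Qed.

End DiameterBound.

Theorem theorem1p6 (R : realType) (X : finType) (Q : X -> X -> R)
    (pi : X -> R) (K : R) (chainQ : finite_markov_chain Q pi) (K_gt0 : 0 < K)
    (cdK : CD_ent Q pi K) :
  (diam_Gamma Q <= (2 / K * Num.sqrt (2 * log_ratio (max_degree Q pi)))%:E)%E.
Proof.
apply: bigmax_le => [|x _]; first exact: leNye.
apply: bigmax_le => [|y _]; first exact: leNye.
apply: ge_ereal_sup => _ [f /= Gf <-]; rewrite lee_fin.
apply: (Gamma_lipschitz chainQ) => // z; apply: le_trans (ler_norm _) _.
exact: (le_trans (le_bigmax _ (fun x => `|Gamma Q f x|) z) Gf).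
Qed.
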